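(* Let $\mathbf P=(P,\le,{}',0,1)$ be a Boolean poset and define \[T(x,y,z):=\operatorname{Min}U\big(L(x,z),L(x,y',z'),L(x',y',z)\big)\] for all $x,y,z\in P$. Then $T$ satisfies, for all $x,y,z\in P$, the identities $T(x,x,z)=z$, $T(x,z,z)=x$ and $T(x,y,x)=x$.
   Context: An orthoposet is a bounded poset $(P,\le,{}',0,1)$ with an antitone involution ${}'$ (i.e. $x\le y$ implies $y'\le x'$, and $x''=x$) that is a complementation (i.e. $x\vee x'=1$ and $x\wedge x'=0$ for all $x$). For $A\subseteq P$: $L(A):=\{x\in P\mid x\le y\text{ for all }y\in A\}$, $U(A):=\{x\in P\mid y\le x\text{ for all }y\in A\}$, and $\operatorname{Min}A$ is the set of all minimal elements of $A$. When several arguments (elements and/or subsets) are listed inside $L$ or $U$, the operator is applied to the union of these sets, elements being read as singletons; $LU(A):=L(U(A))$, $UL(A):=U(L(A))$, etc. Singletons are identified with their unique element (so $T(x,x,z)=z$ means $T(x,x,z)=\{z\}$). A poset is distributive if it satisfies one of the following equivalent identities (for all $x,y,z$): $L\big(U(x,y),z\big)=LU\big(L(x,z),L(y,z)\big)$; $UL\big(U(x,y),z\big)=U\big(L(x,z),L(y,z)\big)$; $U\big(L(x,y),z\big)=UL\big(U(x,z),U(y,z)\big)$; $LU\big(L(x,y),z\big)=L\big(U(x,z),U(y,z)\big)$. A Boolean poset is a distributive orthoposet. *)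

(* Defs.v *)
From mathcomp Require Import all_boot all_order.
From mathcomp Require Import classical_sets.

Set Implicit Arguments.
Unset Strict Implicit.
Unset Printing Implicit Defensive.

Import Order.TTheory.
Local Open Scope order_scope.
Local Open Scope classical_set_scope.

(* [L (A, B)] and [U (A, B)] are rendered as [lbound (A `|` B)] and
   [ubound (A `|` B)], an element [x] being read as [[set x]]. *)

Section Defs.
Variables (d : Order.disp_t).

Definition Min (P : porderType d) (A : set P) : set P :=
  [set x | A x /\ forall y, A y -> y <= x -> y = x].

Definition distributive1 (P : porderType d) : Prop := forall x y z : P,
  lbound (ubound [set x; y] `|` [set z]) =
  lbound (ubound (lbound [set x; z] `|` lbound [set y; z])).

Definition distributive2 (P : porderType d) : Prop := forall x y z : P,
  ubound (lbound (ubound [set x; y] `|` [set z])) =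
  ubound (lbound [set x; z] `|` lbound [set y; z]).

Definition distributive3 (P : porderType d) : Prop := forall x y z : P,
  ubound (lbound [set x; y] `|` [set z]) =
  ubound (lbound (ubound [set x; z] `|` ubound [set y; z])).

Definition distributive4 (P : porderType d) : Prop := forall x y z : P,
  lbound (ubound (lbound [set x; y] `|` [set z])) =
  lbound (ubound [set x; z] `|` ubound [set y; z]).

(* The four identities are equivalent, so requiring at least one of them is the
   usual notion of distributivity. *)
Definition distributive_poset (P : porderType d) : Prop :=
  [\/ distributive1 P, distributive2 P, distributive3 P | distributive4 P].

(* [supremums A x] states that the join of [A] exists and equals [x]; joins and
   meets of other pairs of elements need not exist. *)
Definition complementation (P : tbPOrderType d) (c : P -> P) : Prop :=
  forall x, supremums [set x; c x] \top /\ infimums [set x; c x] \bot.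

Definition orthoposet (P : tbPOrderType d) (c : P -> P) : Prop :=
  [/\ {homo c : x y /~ x <= y}, involutive c & complementation c].

Definition boolean_poset (P : tbPOrderType d) (c : P -> P) : Prop :=
  orthoposet c /\ distributive_poset P.

Definition Tterm (P : porderType d) (c : P -> P) (x y z : P) : set P :=
  Min (ubound (lbound [set x; z] `|` lbound [set x; c y; c z]
               `|` lbound [set c x; c y; z])).

End Defs.

(* Main.v *)
Require Import Defs.
From mathcomp Require Import all_boot all_order.
From mathcomp Require Import classical_sets.

Local Open Scope classical_set_scope.

(** In each of the three substitutions, every cone in [Tterm] that contains
    both an element and its complement collapses to the bottom element and
    imposes nothing on upper bounds.  For [T(x, y, x)] only the principal ideal
    of [x] survives.  For [T(x, x, z)] and [T(x, z, z)] the two surviving cones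
    are L(a, b) and L(a, c b), and [le_of_split] recovers [a] from them:
    this is the poset form of the Boolean law a = (a /\ b) \/ (a /\ c b).  In all
    three cases the set of upper bounds is thus a principal filter, whose only
    minimal element is its generator ([Min_principal]).

    The law [le_of_split] has to be derived from any one of the four forms of
    distributivity.  The first two speak of joins of lower cones and give it at
    once, because [b] and [c b] join to the top.  The last two are their order
    duals; they give the dual law at [c a], which the antitone involution
    carries back. *)

Import Order.TTheory.
Local Open Scope order_scope.

Lemma Min_principal (d : Order.disp_t) (P : porderType d) (A : set P) (a : P) :
  (forall w, A w <-> a <= w) -> Min A = [set a].
Proof.
move=> AP; apply/seteqP; split=> [w [Aw minw] | _ ->].
  by apply/esym/minw; apply/AP.
split=> [|w /AP le_aw le_wa]; first exact/AP.
by apply/le_anti; rewrite le_aw le_wa.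
Qed.

Lemma ubound_TtermP (d : Order.disp_t) (P : porderType d) (c : P -> P)
    (x y z w : P) :
  ubound (lbound [set x; z] `|` lbound [set x; c y; c z]
          `|` lbound [set c x; c y; z]) w <->
  [/\ forall v, v <= x -> v <= z -> v <= w,
      forall v, v <= x -> v <= c y -> v <= c z -> v <= w &
      forall v, v <= c x -> v <= c y -> v <= z -> v <= w].
Proof.
split=> [ub | [h1 h2 h3] v [[lb | lb] | lb]].
- split=> v.
  + by move=> ? ?; apply: ub; left; left=> _ [] ->.
  + by move=> ? ? ?; apply: ub; left; right=> _ [[] | ] ->.
  + by move=> ? ? ?; apply: ub; right=> _ [[] | ] ->.
- by apply: h1; apply: lb; [left | right].
- by apply: h2; apply: lb; [left; left | left; right | right].
- by apply: h3; apply: lb; [left; left | left; right | right].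
Qed.

Section Orthoposet.
Context {d : Order.disp_t} {P : tbPOrderType d} {c : P -> P}.
Hypothesis hO : orthoposet c.

Let cK : involutive c. Proof. by case: hO. Qed.

Lemma compl_le (x y : P) : x <= y -> c y <= c x.
Proof. by case: hO => homo_c _ _; apply: homo_c. Qed.

Lemma compl_le_swap (x y : P) : c x <= y -> c y <= x.
Proof. by move=> /compl_le; rewrite cK. Qed.

Lemma le_compl_swap (x y : P) : x <= c y -> y <= c x.
Proof. by move=> /compl_le; rewrite cK. Qed.

Lemma compl_le_bot (x v w : P) : v <= x -> v <= c x -> v <= w.
Proof.
move=> vx vcx; case: hO => _ _ /(_ x) [_ [_ glb]].
by apply: le_trans (le0x w); apply: glb => _ [] ->.
Qed.

Lemma compl_ge_top (x v w : P) : x <= v -> c x <= v -> w <= v.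
Proof.
move=> xv cxv; case: hO => _ _ /(_ x) [[_ lub] _].
by apply: le_trans (lex1 w) _; apply: lub => _ [] ->.
Qed.

(** Having [b] and [c b] join to the top makes [a] a member of the cone
    L(U(b, c b), a). *)
Lemma mem_lbound_join_compl (a b : P) :
  lbound (ubound [set b; c b] `|` [set a]) a.
Proof.
move=> v [ub | -> //].
by apply: (compl_ge_top b); apply: ub; [left | right].
Qed.

Lemma mem_ubound_meet_compl (a b : P) :
  ubound (lbound [set b; c b] `|` [set a]) a.
Proof.
move=> v [lb | -> //].
by apply: (compl_le_bot b); apply: lb; [left | right].
Qed.

(** The inequality a <= (a /\ b) \/ (a /\ c b), in a form that makes sense when
    these meets and joins do not exist.  Two memberships drive every case: that
    of [a] (or [c a]) in the side of the identity where [b] and [c b] cancel,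
    and that of [w] (or [c w]) in the cone of the two split parts. *)
Lemma le_of_split (a b w : P) : distributive_poset P ->
  (forall v, v <= b -> v <= a -> v <= w) ->
  (forall v, v <= c b -> v <= a -> v <= w) -> a <= w.
Proof.
move=> distrP bw cbw.
have Uw : ubound (lbound [set b; a] `|` lbound [set c b; a]) w.
  by move=> v [lb | lb]; [apply: bw | apply: cbw]; apply: lb;
    [left | right | left | right].
(* The complement turns the upper cones of [b, c a] and [c b, c a] into the
   lower cones of [c b, a] and [b, a]. *)
have Lcw : lbound (ubound [set b; c a] `|` ubound [set c b; c a]) (c w).
  move=> v [] ub; apply: compl_le_swap.
  - apply: cbw; first by apply: compl_le; apply: ub; left.
    by apply: compl_le_swap; apply: ub; right.
  - apply: bw; apply: compl_le_swap; first by apply: ub; left.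
    by apply: ub; right.
have La := mem_lbound_join_compl a b.
have Uca := mem_ubound_meet_compl (c a) b.
case: distrP => [D1 | D2 | D3 | D4].
- by move: La; rewrite D1; apply.
- by move: Uw; rewrite -D2; apply.
- by move: Uca; rewrite D3 => /(_ _ Lcw) /le_compl_swap; rewrite cK.
- by move: Lcw; rewrite -D4 => /(_ _ Uca) /le_compl_swap; rewrite cK.
Qed.

End Orthoposet.

Theorem corollary4p7 (d : Order.disp_t) (P : tbPOrderType d) (c : P -> P)
    (hP : boolean_poset c) (x y z : P) :
  [/\ Tterm c x x z = [set z],
      Tterm c x z z = [set x] &
      Tterm c x y x = [set x]].
Proof.
case: hP => hO hD.
split; apply: Min_principal => w; rewrite ubound_TtermP; split.
- case=> h1 _ h3; apply: (le_of_split hO z x) => // v vcx.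
  exact: h3.
- move=> zw; split=> v; first by move=> _ /le_trans; apply.
    by move=> vx vcx _; apply: (compl_le_bot hO x).
  by move=> _ _ /le_trans; apply.
- case=> h1 h2 _; apply: (le_of_split hO x z) => // v vz vx.
    exact: h1.
  exact: h2.
- move=> xw; split=> v; first by move=> /le_trans + _; apply.
    by move=> /le_trans + _ _; apply.
  by move=> _ vcz vz; apply: (compl_le_bot hO z).
- by case=> h1 _ _; apply: h1.
- move=> xw; split=> v; first by move=> /le_trans + _; apply.
    by move=> /le_trans + _ _; apply.
  by move=> vcx _ vx; apply: (compl_le_bot hO x).
Qed.
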